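(* Let $H<H'$ be consecutive highly composite numbers. Then no element of the closed exponent box $\mathcal B(H,H')$ lies numerically strictly between $H$ and $H'$; that is, $$\mathcal B(H,H')\cap(H,H')=\varnothing,$$ where $(H,H')$ is the open interval.
   Context: $d(n)$ denotes the number of positive divisors of $n$. A positive integer $H$ is highly composite if $d(m)<d(H)$ for all integers $1\le m<H$. Two highly composite numbers $H<H'$ are consecutive if no highly composite number lies strictly between them. For $m=\prod_p p^{a_p}$ and $n=\prod_p p^{b_p}$, the closed exponent box is $$\mathcal B(m,n)=\Bigl\{\prod_p p^{e_p}:\ \min(a_p,b_p)\le e_p\le\max(a_p,b_p)\text{ for all primes }p\Bigr\}.$$ *)

(* Defs.v *)
From mathcomp Require Import all_boot.

Set Implicit Arguments.
Unset Strict Implicit.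
Unset Printing Implicit Defensive.

Definition num_divisors (n : nat) : nat := size (divisors n).

Definition highly_composite (H : nat) : Prop :=
  0 < H /\ forall m : nat, 1 <= m < H -> num_divisors m < num_divisors H.

Definition consecutive_hc (H H' : nat) : Prop :=
  [/\ highly_composite H, highly_composite H', H < H' &
      ~ exists K : nat, highly_composite K /\ H < K < H'].

(* A positive integer x is identified with its exponent family
   p |-> logn p x; positivity is required because logn p 0 = 0. *)
Definition in_exponent_box (m n x : nat) : Prop :=
  0 < x /\
  forall p : nat, prime p ->
    minn (logn p m) (logn p n) <= logn p x <= maxn (logn p m) (logn p n).

(* Main.v *)
Require Import Defs.
From mathcomp Require Import all_boot zify.

(** Reflection through the box: if [x] lies in the box then so does
    [y = H * H' / x], and [H < x < H'] forces [H < y < H'].  At each prime the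
    exponents of [x] and [y] have the same sum as those of [H] and [H'] but are
    closer together, so [d H * d H' <= d x * d y].  But below [H'] no number has
    more than [d H < d H'] divisors, so [d x * d y <= d H * d H < d H * d H']. *)

Lemma num_divisors_primes n :
  num_divisors n = \prod_(p <- primes n) (logn p n).+1.
Proof.
transitivity (\prod_(f <- prime_decomp n) f.2.+1); last first.
  by rewrite prime_decompE big_map.
rewrite /num_divisors /divisors.
elim: prime_decomp => [|[p e] s IHs] /=; first by rewrite big_nil.
rewrite big_cons -IHs /=; move: (foldr _ _ s) => ds.
(* Each of the [e] iterations adds [size ds] entries to the list, starting from [ds] itself. *)
elim: e => [|e IHe] /=; first by rewrite mul1n.
by rewrite size_merge size_cat size_map IHe -mulSnr.
Qed.

(** A common index range lets several divisor counts be compared factor by factor; indices that are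
    not prime divisors of [n] contribute 1. *)
Lemma num_divisors_ord n N : 0 < n < N ->
  num_divisors n = \prod_(p < N) (logn p n).+1.
Proof.
case/andP=> n_gt0 ltnN; rewrite num_divisors_primes.
rewrite -(big_mkord xpredT (fun p => (logn p n).+1)).
rewrite [RHS](bigID (mem (primes n)) xpredT) /=.
rewrite [X in _ * X]big1 ?muln1; last first.
  by move=> p; rewrite -logn_gt0 -eqn0Ngt => /eqP ->.
rewrite -[RHS]big_filter; apply/perm_big/uniq_perm.
- exact: primes_uniq.
- by rewrite filter_uniq // iota_uniq.
move=> p; rewrite mem_filter mem_index_iota /=.
case: (boolP (p \in primes n)) => //=.
by rewrite mem_primes n_gt0 => /andP[_ /(dvdn_leq n_gt0) /leq_ltn_trans ->].
Qed.

(** By strong induction, a least violating [m] would be highly composite and strictly between [H]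
    and [H']. *)
Lemma num_divisors_le_below_next H H' m :
  consecutive_hc H H' -> 0 < m < H' -> num_divisors m <= num_divisors H.
Proof.
case=> [[_ Hmax] _ _ noK]; elim/ltn_ind: m => m IHm /andP[m_gt0 ltmH'].
case: (ltngtP m H) => [ltmH | ltHm | -> //].
  by apply/ltnW/Hmax; rewrite m_gt0.
rewrite leqNgt; apply/negP=> lt_d; apply: noK; exists m.
split; last by rewrite ltHm.
split=> // k /andP[k_gt0 ltkm]; apply: leq_ltn_trans lt_d.
by apply: IHm; rewrite // k_gt0 (ltn_trans ltkm).
Qed.

(** At each prime max(a, b) <= a + b. The quotient is the reflected point [y]. *)
Lemma in_exponent_box_dvdn m n x :
  0 < m -> 0 < n -> in_exponent_box m n x -> x %| m * n.
Proof.
move=> m_gt0 n_gt0 [x_gt0 box].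
apply/dvdn_partP=> // p; rewrite mem_primes => /andP[p_pr _].
rewrite p_part pfactor_dvdn ?muln_gt0 ?m_gt0 // lognM //.
by have := box p p_pr; lia.
Qed.

(* With the sum of the exponents fixed at each prime, the product of their
   successors is smallest at the extreme pair. *)
Lemma num_divisors_box_mul m n x y :
  0 < m -> 0 < n -> in_exponent_box m n x -> x * y = m * n ->
  num_divisors m * num_divisors n <= num_divisors x * num_divisors y.
Proof.
move=> m_gt0 n_gt0 [x_gt0 box] xy.
have /andP[_ y_gt0]: (0 < x) && (0 < y) by rewrite -muln_gt0 xy muln_gt0 m_gt0.
pose N := (m + n + x + y).+1.
rewrite !(num_divisors_ord _ N) ?m_gt0 ?n_gt0 ?x_gt0 ?y_gt0 /=; try lia.
rewrite -!big_split /=; apply: leq_prod => p _.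
case: (boolP (prime p)) => [p_pr | npr]; last by rewrite /logn !(negPf npr).
have := congr1 (logn p) xy; rewrite !lognM //.
(* For exponents a, b of [m], [n] and e of [x], the right side exceeds the left by (e - a)(b - e) >=
   0. *)
have := box p p_pr; nia.
Qed.

Theorem theorem4p2 (H H' : nat) (hc : consecutive_hc H H') :
  ~ exists x : nat, in_exponent_box H H' x /\ H < x < H'.
Proof.
case=> x [box /andP[ltHx ltxH']].
have [[H_gt0 _] [H'_gt0 H'max] ltHH' _] := hc.
have /dvdnP[y] := in_exponent_box_dvdn _ _ _ H_gt0 H'_gt0 box.
rewrite [y * x]mulnC => /esym xy.
have /andP[x_gt0 y_gt0]: (0 < x) && (0 < y).
  by rewrite -muln_gt0 xy muln_gt0 H_gt0.
have ltyH': y < H' by rewrite -(ltn_pmul2l x_gt0) xy ltn_pmul2r.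
have lex: num_divisors x <= num_divisors H.
  by apply: num_divisors_le_below_next _ _ _ hc _; lia.
have lty: num_divisors y < num_divisors H' by apply: H'max; rewrite y_gt0.
have dH_gt0: 0 < num_divisors H.
  by rewrite num_divisors_primes prodn_gt0.
have := num_divisors_box_mul _ _ _ _ H_gt0 H'_gt0 box xy.
apply/negP; rewrite -ltnNge.
apply: (@leq_ltn_trans (num_divisors H * num_divisors y)).
  by rewrite leq_mul2r lex orbT.
by rewrite ltn_pmul2l.
Qed.
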